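(* Let $k,m\in\mathbb N\setminus\{0\}$, $p\in\mathbb R\setminus\{0\}$, and let $a(x,\xi)=(x^{2k}+\xi^{2m})^p$ for $x,\xi\in\mathbb R$. If $(y,\eta)\in\mathbb R^2$ and $c=y^{2k}+\eta^{2m}>0$, then the Hamilton system $$x'(t)=2mp\,c^{p-1}\xi(t)^{2m-1},\quad \xi'(t)=-2kp\,c^{p-1}x(t)^{2k-1},\quad x(0)=y,\quad \xi(0)=\eta$$ (the Hamilton system of $a$, simplified by conservation of $a$ along solution curves) has a unique solution $\chi_t(y,\eta)=(x(t),\xi(t))$ with domain $\mathbb R$. It is smooth and periodic with respect to $t\in\mathbb R$, and has the following form, where $T_j,f_j$ $(j=1,2,3,4)$ and $T$ are as defined in the context. If $\eta\ne0$ then $$x(t)=f_1(t),\quad \xi(t)=f_2(t),\qquad T_1\le t\le T_2,$$ $$x(t)=f_1(2T_2-t),\quad \xi(t)=-f_2(2T_2-t),\qquad T_2\le t\le 2T_2-T_1,$$ and $$x(t)=x(t-nT),\quad \xi(t)=\xi(t-nT),\qquad T_1+nT\le t\le T_1+(n+1)T,\quad n\in\mathbb Z.$$ If $y\ne0$ then $$x(t)=f_3(t),\quad \xi(t)=-f_4(t),\qquad T_3\le t\le T_4,$$ $$x(t)=-f_3(2T_4-t),\quad \xi(t)=-f_4(2T_4-t),\qquad T_4\le t\le 2T_4-T_3,$$ and $$x(t)=x(t-nT),\quad \xi(t)=\xi(t-nT),\qquad T_3+nT\le t\le T_3+(n+1)T,\quad n\in\mathbb Z.$$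
   Context: For $k,m\in\mathbb N\setminus\{0\}$ define $g_{k,m}(x)=\int_0^x(1-t^{2k})^{\frac1{2m}-1}\,dt$ for $x\in[-1,1]$; it is continuous, odd and strictly increasing on $[-1,1]$. Let $\tau_{k,m}=\lim_{x\to1^-}g_{k,m}(x)>0$, so that $g_{k,m}^{-1}:[-\tau_{k,m},\tau_{k,m}]\to[-1,1]$ is continuous, odd and strictly increasing. Put $\omega=p-\frac1{2m}-\frac1{2k}$ and $c=y^{2k}+\eta^{2m}$. If $\eta\ne0$, let $\gamma=g_{k,m}(\operatorname{sgn}(\eta)\,y\,c^{-\frac1{2k}})$, $$T_1=(2mp)^{-1}c^{-\omega}(-\tau_{k,m}-\gamma)<0,\quad T_2=(2mp)^{-1}c^{-\omega}(\tau_{k,m}-\gamma)>0,\quad T=2(T_2-T_1)=\frac{2\tau_{k,m}}{mp}c^{-\omega}>0,$$ $$f_1(t)=\operatorname{sgn}(\eta)\,c^{\frac1{2k}}g_{k,m}^{-1}\big(2mp\,c^{\omega}t+\gamma\big),\qquad f_2(t)=\operatorname{sgn}(\eta)\,c^{\frac1{2m}}\Big(1-\big(g_{k,m}^{-1}(2mp\,c^{\omega}t+\gamma)\big)^{2k}\Big)^{\frac1{2m}}$$ for $T_1\le t\le T_2$. If $y\ne0$, let $\kappa=g_{m,k}(\operatorname{sgn}(y)\,\eta\,c^{-\frac1{2m}})$, $$T_3=(2kp)^{-1}c^{-\omega}(-\tau_{m,k}+\kappa)<0,\quad T_4=(2kp)^{-1}c^{-\omega}(\tau_{m,k}+\kappa)>0,\quad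 T=2(T_4-T_3)=\frac{2\tau_{m,k}}{kp}c^{-\omega}>0,$$ $$f_3(t)=\operatorname{sgn}(y)\,c^{\frac1{2k}}\Big(1-\big(g_{m,k}^{-1}(2kp\,c^{\omega}t-\kappa)\big)^{2m}\Big)^{\frac1{2k}},\qquad f_4(t)=\operatorname{sgn}(y)\,c^{\frac1{2m}}g_{m,k}^{-1}\big(2kp\,c^{\omega}t-\kappa\big)$$ for $T_3\le t\le T_4$. (The two expressions for $T$ agree when $y\neq0\neq\eta$, since $\tau_{m,k}=\frac km\tau_{k,m}$.) *)

(* Defs.v *)
From HB Require Import structures.
From mathcomp Require Export all_boot all_order all_algebra.
From mathcomp Require Export all_classical all_reals all_analysis.
Export Order.TTheory GRing.Theory Num.Theory.
Export numFieldNormedType.Exports.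

Set Implicit Arguments.
Unset Strict Implicit.
Unset Printing Implicit Defensive.

Local Open Scope classical_set_scope.
Local Open Scope ring_scope.

(* Oriented integral from 0 to x. The integrand may be singular at -1 and 1,
   hence the Lebesgue integral; its value at those two points ([0 `^ e] is
   total) is irrelevant. Only meaningful for x in [-1, 1]. *)
Definition gint (R : realType) (k m : nat) (x : R) : R :=
  let f t := (1 - t ^+ (2 * k)) `^ ((2 * m)%:R^-1 - 1) in
  if 0 <= x then \int[lebesgue_measure]_(t in `[0, x]) f t
  else - \int[lebesgue_measure]_(t in `[x, 0]) f t.

Definition tau (R : realType) (k m : nat) : R :=
  lim (gint k m x @[x --> (1 : R)^'-]).

(* Inverse of the restriction of [gint k m] to [-1, 1]; total, with a junk value
   outside the image of [-1, 1]. *)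
Definition ginv (R : realType) (k m : nat) : R -> R :=
  'pinv_(fun=> 0) `[-1, 1] (gint k m).

Definition omega (R : realType) (k m : nat) (p : R) : R :=
  p - (2 * m)%:R^-1 - (2 * k)%:R^-1.

Definition energy (R : realType) (k m : nat) (y eta : R) : R :=
  y ^+ (2 * k) + eta ^+ (2 * m).

Definition gamma0 (R : realType) (k m : nat) (y eta : R) : R :=
  let c := energy k m y eta in
  gint k m (Num.sg eta * y * c `^ (- (2 * k)%:R^-1)).

Definition kappa0 (R : realType) (k m : nat) (y eta : R) : R :=
  let c := energy k m y eta in
  gint m k (Num.sg y * eta * c `^ (- (2 * m)%:R^-1)).

Definition T1 (R : realType) (k m : nat) (p y eta : R) : R :=
  let c := energy k m y eta in
  (2 * m%:R * p)^-1 * c `^ (- omega k m p) * (- tau R k m - gamma0 k m y eta).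

Definition T2 (R : realType) (k m : nat) (p y eta : R) : R :=
  let c := energy k m y eta in
  (2 * m%:R * p)^-1 * c `^ (- omega k m p) * (tau R k m - gamma0 k m y eta).

Definition T3 (R : realType) (k m : nat) (p y eta : R) : R :=
  let c := energy k m y eta in
  (2 * k%:R * p)^-1 * c `^ (- omega k m p) * (- tau R m k + kappa0 k m y eta).

Definition T4 (R : realType) (k m : nat) (p y eta : R) : R :=
  let c := energy k m y eta in
  (2 * k%:R * p)^-1 * c `^ (- omega k m p) * (tau R m k + kappa0 k m y eta).

Definition f1 (R : realType) (k m : nat) (p y eta t : R) : R :=
  let c := energy k m y eta in
  Num.sg eta * c `^ ((2 * k)%:R^-1) *
  ginv k m (2 * m%:R * p * c `^ omega k m p * t + gamma0 k m y eta).

Definition f2 (R : realType) (k m : nat) (p y eta t : R) : R :=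
  let c := energy k m y eta in
  Num.sg eta * c `^ ((2 * m)%:R^-1) *
  (1 - ginv k m (2 * m%:R * p * c `^ omega k m p * t + gamma0 k m y eta)
         ^+ (2 * k)) `^ ((2 * m)%:R^-1).

Definition f3 (R : realType) (k m : nat) (p y eta t : R) : R :=
  let c := energy k m y eta in
  Num.sg y * c `^ ((2 * k)%:R^-1) *
  (1 - ginv m k (2 * k%:R * p * c `^ omega k m p * t - kappa0 k m y eta)
         ^+ (2 * m)) `^ ((2 * k)%:R^-1).

Definition f4 (R : realType) (k m : nat) (p y eta t : R) : R :=
  let c := energy k m y eta in
  Num.sg y * c `^ ((2 * m)%:R^-1) *
  ginv m k (2 * k%:R * p * c `^ omega k m p * t - kappa0 k m y eta).

(* Hamilton system of a(x, xi) = (x^(2k) + xi^(2m))^p with initial value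
   (y, eta), where x^(2k) + xi^(2m) has been replaced by its conserved value. *)
Definition hamilton_solution (R : realType) (k m : nat) (p y eta : R)
    (x xi : R -> R) : Prop :=
  let c := energy k m y eta in
  [/\ forall t, is_derive t (1 : R) x
        (2 * m%:R * p * c `^ (p - 1) * xi t ^+ (2 * m - 1)),
      forall t, is_derive t (1 : R) xi
        (- (2 * k%:R * p * c `^ (p - 1) * x t ^+ (2 * k - 1))),
      x 0 = y
    & xi 0 = eta].

Definition smooth (R : realType) (f : R -> R) : Prop :=
  forall (n : nat) (t : R), derivable (derive1n n f) t 1.

(* Closed interval with endpoints a and b in either order: for p < 0 one has
   T2 < 0 < T1 and T4 < 0 < T3. For a <= b it is a <= t <= b. *)
Definition between (R : realType) (a b t : R) : bool :=
  Num.min a b <= t <= Num.max a b.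

(* Main.v *)
Require Import Defs.
From mathcomp Require Import ring lra measurable_realfun.

Set Implicit Arguments.
Unset Strict Implicit.
Unset Printing Implicit Defensive.

Local Open Scope classical_set_scope.
Local Open Scope ring_scope.

(** Rescaling the unknowns by powers of the energy c and time by
    [2 m p c^omega] turns the system into
        u' = v^(2m-1),   v' = - (k/m) u^(2k-1),
    whose curve on the unit energy level u^(2k) + v^(2m) = 1 is a generalized
    pair (sine, cosine); the initial point becomes the phase gamma. As long as
    v >= 0 one has v = (1 - u^(2k))^(1/(2m)), so that u' is the reciprocal of
    the derivative of [gint k m] at u, and u is the inverse function [ginv k m]
    on [-tau, tau]. After that time span both coordinates have run through half
    of the closed curve, and the other half is its image under
    (u, v) |-> (-u, -v). Hence the global pair ([gsin], [gcos]) is the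
    2 tau-antiperiodic extension of the pair on [-tau, tau].

    Two points need work. First, the integrand of [gint] is singular at -1 and
    1; it is integrable there because it is dominated by the derivative of a
    bounded continuous function ([ge0_integrable_derivative]), and then [gint]
    is continuous up to the end points. Secondly, the derivative of the glued
    functions at the junctions is not given by the inverse function theorem;
    it is the limit of the derivatives nearby ([is_derive_punctured]), since
    the right-hand sides of the system are continuous functions of (u, v).

    Uniqueness: the energy is conserved, so all solutions stay in one compact
    set, where the vector field is Lipschitz, and Gronwall's inequality applies
    to the squared distance of two solutions. Smoothness: the derivative of a
    polynomial in (x, xi) is again such a polynomial.

    The formulas for y != 0 need no second computation: the rotation
    (x, xi) |-> (-xi, x) exchanges k and m, and (y, eta) with (-eta, y)
    ([hamilton_rotate]). By uniqueness both descriptions concern the same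
    solution. *)

(** * Calculus: derivatives by continuity, powers, improper integrals *)

(** By the mean value theorem each difference quotient at [a] is a value of [h]
    at a point still closer to [a]; this gives the derivative at a junction of
    two formulas from the equation on both sides of it. *)
Lemma is_derive_punctured (R : realType) (f h : R -> R) (a e : R) :
  0 < e -> {for a, continuous f} -> {for a, continuous h} ->
  (forall t, t != a -> `|t - a| < e -> is_derive t (1 : R) f (h t)) ->
  is_derive a (1 : R) f (h a).
Proof.
move=> e0 fa ha df.
apply/is_derive1_caratheodory.
exists (fun z => if z == a then h a else (f z - f a) / (z - a)); split.
- move=> z; case: eqP => [->|/eqP]; first by rewrite !subrr mulr0.
  by rewrite -subr_eq0 => /divfK->.
- have slope z : z != a -> `|z - a| < e ->
    exists2 c, `|c - a| <= `|z - a| & (f z - f a) / (z - a) = h c.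
    move=> za zae.
    have fc t : `|t - a| < e -> {for t, continuous f}.
      have [->//|ta te] := eqVneq t a.
      have dft := df t ta te.
      exact/differentiable_continuous/derivable1_diffP.
    have [az|az|az] := ltgtP a z; last by rewrite az eqxx in za.
    + have [||c /[!in_itv]/= /andP[ac cz] fE] := @MVT _ f h _ _ az.
      * move=> t /[!in_itv]/= /andP[a_t tz]; apply: df; first by rewrite gt_eqF.
        by rewrite (lt_trans _ zae)// !gtr0_norm ?subr_gt0// ltrD2r.
      * apply: continuous_in_subspaceT => t /[!inE]/= /[!in_itv]/= /andP[a_t tz].
        apply: fc; rewrite (le_lt_trans _ zae)// !ger0_norm ?subr_ge0//.
          by rewrite lerD2r.
        exact: ltW.
      * exists c; last by rewrite fE mulfK// subr_eq0.
        by rewrite !gtr0_norm ?subr_gt0// lerD2r ltW.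
    + have [||c /[!in_itv]/= /andP[zc ca] fE] := @MVT _ f h _ _ az.
      * move=> t /[!in_itv]/= /andP[zt ta]; apply: df; first by rewrite lt_eqF.
        by rewrite (lt_trans _ zae)// !ltr0_norm ?subr_lt0// ltrN2 ltrD2r.
      * apply: continuous_in_subspaceT => t /[!inE]/= /[!in_itv]/= /andP[zt ta].
        apply: fc; rewrite (le_lt_trans _ zae)// !ler0_norm ?subr_le0//.
          by rewrite lerN2 lerD2r.
        exact: ltW.
      * exists c; last by rewrite -opprB fE -mulrN opprB mulfK// subr_eq0.
        by rewrite !ltr0_norm ?subr_lt0// lerN2 lerD2r ltW.
  apply/cvgrPdist_lt => d d0 /=; rewrite eqxx.
  move/cvgrPdist_lt : ha => /(_ d d0) [r /= r0 har].
  exists (Num.min r e); rewrite /= ?lt_min ?r0// => z /=.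
  rewrite lt_min => /andP[zr ze].
  case: eqP => [_|/eqP za]; first by rewrite subrr normr0.
  have [|c ca ->] := slope z za; first by rewrite distrC.
  by apply: har => /=; rewrite distrC (le_lt_trans ca)// distrC.
- by rewrite eqxx.
Qed.

(** The absolute value is essential: [x `^ r] is 1 for negative x, so it is not
    continuous at 0. *)
Lemma continuous_normr_powR (R : realType) (r : R) : 0 < r ->
  continuous (fun x : R => `|x| `^ r).
Proof.
move=> r0 x; have [->|x0] := eqVneq x 0.
  rewrite /continuous_at normr0 powR0 ?gt_eqF//.
  apply/cvgrPdist_lt => d d0 /=.
  exists (d `^ r^-1) => /=; first by rewrite powR_gt0.
  move=> z /=; rewrite !sub0r !normrN => zd.
  rewrite ger0_norm ?powR_ge0//.
  have -> : d = (d `^ r^-1) `^ r by rewrite -powRrM mulVf ?gt_eqF// powRr1 ?ltW.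
  by apply: gt0_ltr_powR => //; rewrite nnegrE ?powR_ge0.
apply: (@continuous_comp _ _ _ (@Num.norm R R) (fun y => y `^ r));
  first exact: norm_continuous.
apply: differentiable_continuous; apply/derivable1_diffP.
by apply: derivable_powR; rewrite in_itv/= andbT normr_gt0.
Qed.

(** Exhaust ]a, b[ by segments: on each of them the fundamental theorem of
    calculus bounds the integral by the total increase of the nondecreasing
    function [F], and monotone convergence passes to the limit. This
    covers functions [f] that are unbounded near the end points. *)
Lemma ge0_integrable_derivative (R : realType) (f F : R -> R) (a b : R) :
  a < b -> {in `]a, b[, forall x, 0 <= f x} ->
  {in `]a, b[, continuous f} ->
  {within `[a, b], continuous F} ->
  {in `]a, b[, forall x, is_derive x (1 : R) F (f x)} ->
  (\int[lebesgue_measure]_(x in `]a, b[) (f x)%:E <= (F b - F a)%:E)%E.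
Proof.
move=> ab f0 cf cF dF.
pose d n : R := (b - a) / n.+3%:R.
have d0 n : 0 < d n by rewrite divr_gt0 ?subr_gt0.
pose S n := `[a + d n, b - d n]%classic.
have Sab n : a + d n < b - d n.
  rewrite ltrBrDr -addrA -ltrBrDl /d -mulr2n -mulrnAl -[ltRHS]divr1.
  rewrite ltr_pdivrMr// divr1 -mulr_natr ltr_pM2l ?subr_gt0//.
  by rewrite ltr_nat.
have SE n : S n `<=` `]a, b[%classic.
  move=> x; rewrite /S/= !in_itv/= => /andP[h1 h2].
  have := d0 n => ?; apply/andP; split; lra.
(* a point x of ]a, b[ lies in S n once d n is below its distance to a and b *)
have bigS : \bigcup_n S n = `]a, b[%classic.
  apply/seteqP; split => [x [n _ /SE]//|x].
  rewrite /= in_itv/= => /andP[ax xb].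
  pose r := Num.min (x - a) (b - x).
  have r0 : 0 < r by rewrite lt_min !subr_gt0 ax xb.
  pose n := Num.truncn ((b - a) / r).
  exists n => //; have dr : d n < r.
    rewrite /d ltr_pdivrMr// mulrC -ltr_pdivrMr//.
    apply: (lt_le_trans (truncnS_gt _)).
    by rewrite ler_nat ltnS leqW.
  have : d n < x - a /\ d n < b - x by move: dr; rewrite lt_min => /andP.
  by rewrite /S/= in_itv/= => -[? ?]; apply/andP; split; lra.
have SS : nondecreasing_seq S.
  apply/nondecreasing_seqP => n; rewrite subsetEset => x.
  have dd : d n.+1 <= d n by
    rewrite /d ler_pM2l ?subr_gt0// lef_pV2 ?posrE// ler_nat.
  rewrite /S/= !in_itv/= => /andP[? ?]; apply/andP; split; lra.
have Sf n : {within S n, continuous f}.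
  by apply: continuous_in_subspaceT => x /[!inE] /SE; exact: cf.
have mf n : measurable_fun (S n) (EFin \o f).
  apply/measurable_EFinP; apply: subspace_continuous_measurable_fun => //.
  exact: measurable_itv.
rewrite -bigS.
apply: cvge_le; last first.
  have H := @ge0_nondecreasing_set_cvg_integral _ (measurableTypeR R) R S
    (EFin \o f) lebesgue_measure SS.
  apply: H => [n|n|n x /SE].
  - exact: measurable_itv.
  - exact: mf.
  - by rewrite lee_fin; exact: f0.
apply: nearW => n.
have ndF : {in `[a, b] &, {homo F : x y / x <= y}}.
  apply: ger0_derive1_le_cc => //.
    by move=> x /dF.
  move=> x xab; have := dF x xab => dFx; rewrite derive1E derive_val.
  exact: f0.
have dn := d0 n; have Sn := Sab n.
rewrite (@continuous_FTC2 _ f F)//.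
- rewrite -EFinB lee_fin lerB// ndF// ?in_itv/=; lra.
- exact: Sf.
- have Fc t : t \in `]a, b[ -> F x @[x --> t] --> F t.
    move=> tab; have dFt := dF t tab.
    exact/differentiable_continuous/derivable1_diffP.
  split.
  + move=> x /[!in_itv]/= /andP[? ?]; have dFx := dF x.
    have : x \in `]a, b[ by rewrite in_itv/=; apply/andP; split; lra.
    by move=> /dFx.
  + by apply/cvg_at_right_filter/Fc; rewrite in_itv/=; apply/andP; split; lra.
  + by apply/cvg_at_left_filter/Fc; rewrite in_itv/=; apply/andP; split; lra.
- move=> x /[!in_itv]/= /andP[? ?].
  have xab : x \in `]a, b[ by rewrite in_itv/=; apply/andP; split; lra.
  by have := dF x xab => dFx; rewrite derive1E derive_val.
Unshelve. all: exact: eventually_filter. Qed.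

Lemma is_derive_powR_comp (R : realType) (g : R -> R) (s t dg : R) :
  0 < g t -> is_derive t (1 : R) g dg ->
  is_derive t (1 : R) (fun x => g x `^ s) (s * g t `^ (s - 1) * dg).
Proof.
move=> gt0 dgt; apply: (@is_derive1_comp _ (fun x => x `^ s) g).
exact: is_derive1_powR.
Qed.

Lemma continuous_powR_comp (R : realType) (g : R -> R) (s t : R) :
  0 < g t -> {for t, continuous g} -> {for t, continuous (fun x => g x `^ s)}.
Proof.
move=> gt0 gc; apply: (@continuous_comp _ _ _ g (fun x => x `^ s)) => //.
apply: differentiable_continuous; apply/derivable1_diffP.
by apply: derivable_powR; rewrite in_itv/= andbT.
Qed.

Lemma is_derive_exprn_comp (R : realType) (g : R -> R) (n : nat) (t dg : R) :
  (0 < n)%N -> is_derive t (1 : R) g dg ->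
  is_derive t (1 : R) (fun x => g x ^+ n) (n%:R * g t ^+ (n - 1) * dg).
Proof.
case: n => // n _ dgt; rewrite subn1 /=.
have -> : (fun x => g x ^+ n.+1) = g ^+ n.+1.
  by apply/funext => x; rewrite fctE.
exact: is_deriveX.
Qed.

(** * Integrability of the singular integrand *)

Section ArcLength.
Context {R : realType} (k m : nat).
Hypotheses (hk : (0 < k)%N) (hm : (0 < m)%N).

Local Notation r := ((2 * m)%:R^-1 : R).
Local Notation w := (fun t : R => (1 - t ^+ (2 * k)) `^ (r - 1)).
Local Notation mu := (@lebesgue_measure R).

Let r0 : 0 < r. Proof. by rewrite invr_gt0 ltr0n muln_gt0. Qed.

Let r1 : r < 1. 
Proof. by rewrite invf_lt1 ?ltr0n ?muln_gt0// ltr1n; case: m hm => // -[]. Qed.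

(** Lower bound by which the singularities of the integrand at -1 and 1 are
    compared with powers of 1 - t and 1 + t. *)
Lemma one_sub_exprn_ge (t : R) : -1 <= t <= 1 -> 1 - `|t| <= 1 - t ^+ (2 * k).
Proof.
move=> /andP[t1 t2].
rewrite lerB// -[t ^+ _]ger0_norm ?exprn_even_ge0 ?oddM// normrX.
rewrite -[leRHS]expr1 ler_wiXn2l// ?ler_norml ?t1 ?muln_gt0//.
Qed.

Lemma one_sub_exprn_gt0 (t : R) : -1 < t < 1 -> 0 < 1 - t ^+ (2 * k).
Proof.
move=> t1; apply: (lt_le_trans _ (one_sub_exprn_ge _)).
  by rewrite subr_gt0 ltr_norml.
by move: t1 => /andP[/ltW-> /ltW->].
Qed.

Lemma weight_gt0 (t : R) : -1 < t < 1 -> 0 < w t.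
Proof. by move=> t1; rewrite powR_gt0// one_sub_exprn_gt0. Qed.

Lemma weight_continuous (t : R) : -1 < t < 1 -> {for t, continuous w}.
Proof.
move=> t1; apply: continuous_powR_comp; first exact: one_sub_exprn_gt0.
by apply: continuousB; [exact: cst_continuous|exact: exprn_continuous].
Qed.

(** The exponent r - 1 is negative, so the integrand is at most
    (1 - |t|)^(r - 1) <= (1 - t)^(r - 1) + (1 + t)^(r - 1), and the right-hand
    side has the antiderivative F, which is continuous on [-1, 1] as r > 0. *)
Lemma weight_integrable : mu.-integrable `[-1, 1] (EFin \o w).
Proof.
pose h t : R := (1 - t) `^ (r - 1) + (1 + t) `^ (r - 1).
have h0 t : 0 <= h t by rewrite addr_ge0 ?powR_ge0.
pose F t : R := r^-1 * (`|1 + t| `^ r - `|1 - t| `^ r).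
have mh : measurable_fun setT h.
  by apply: measurable_funD; apply: (measurableT_comp (measurable_powR _));
    [exact: measurable_funB|exact: measurable_funD].
have mw : measurable_fun setT w.
  apply: (measurableT_comp (measurable_powR _)).
  by apply: measurable_funB => //; exact: measurable_funX.
have ih : (\int[mu]_(x in `[(-1)%R, 1%R]) (h x)%:E < +oo)%E.
  rewrite integral_itv_bndoo; last first.
    by apply/measurable_EFinP; exact: measurable_funTS.
  apply: le_lt_trans (ltry (F 1 - F (-1))).
  apply: ge0_integrable_derivative => //.
  - move=> t /[!in_itv]/= /andP[? ?].
    apply: (@continuousD _ _ _ (fun t : R => (1 - t) `^ (r - 1))
      (fun t : R => (1 + t) `^ (r - 1))).
    + apply: continuous_powR_comp; first by rewrite subr_gt0.
      by apply: continuousB; [exact: cst_continuous|exact: cvg_id].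
    + apply: continuous_powR_comp; first by lra.
      by apply: continuousD; [exact: cst_continuous|exact: cvg_id].
  - apply: continuous_subspaceT => t.
    have c1 : {for t, continuous (fun t : R => `|1 + t| `^ r)}.
      apply: (@continuous_comp R R R (fun t => 1 + t) (fun x => `|x| `^ r)).
        by apply: continuousD; [exact: cst_continuous|exact: cvg_id].
      exact: continuous_normr_powR.
    have c2 : {for t, continuous (fun t : R => `|1 - t| `^ r)}.
      apply: (@continuous_comp R R R (fun t => 1 - t) (fun x => `|x| `^ r)).
        by apply: continuousB; [exact: cst_continuous|exact: cvg_id].
      exact: continuous_normr_powR.
    by apply: cvgM; [exact: cvg_cst|exact: cvgB].
  - move=> t /[!in_itv]/= /andP[t1 t2].
    apply: (@near_eq_is_derive R R R
      (fun t => r^-1 * ((1 + t) `^ r - (1 - t) `^ r)) F t 1).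
      near=> s; rewrite /F !ger0_norm//.
        rewrite subr_ge0 ltW//; near: s; exact: lt_nbhsl.
      rewrite -lerBlDl sub0r ltW//; near: s; exact: lt_nbhsr.
    have q1 : is_derive t (1 : R) (fun t => (1 + t) `^ r)
        (r * (1 + t) `^ (r - 1) * 1).
      apply: is_derive_powR_comp; first by lra.
      by apply: is_derive_eq; rewrite add0r.
    have q2 : is_derive t (1 : R) (fun t => (1 - t) `^ r)
        (r * (1 - t) `^ (r - 1) * -1).
      apply: is_derive_powR_comp; first by lra.
      by apply: is_derive_eq; rewrite add0r mul1r.
    apply: is_derive_eq.
    rewrite /h mulr1 mulrN1 opprK /GRing.scale/= -mulrDr mulrA mulVf
      ?mul1r 1?addrC//.
    by rewrite gt_eqF.
have inth : mu.-integrable `[-1, 1] (EFin \o h).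
  apply/integrableP; split; first by
    apply/measurable_EFinP; exact: measurable_funTS.
  by under eq_integral => x _ do rewrite /= ger0_norm//.
apply: le_integrable inth => //; first by
  apply/measurable_EFinP; exact: measurable_funTS.
move=> t /=; rewrite in_itv/= => /andP[t1 t2].
rewrite lee_fin !ger0_norm ?powR_ge0//.
(* at t = 1 and t = -1 the total power [0 `^ (r - 1)] takes the value 0 *)
have [tE|tN] := eqVneq `|t| 1.
  rewrite -[t ^+ _]ger0_norm ?exprn_even_ge0 ?oddM// normrX tE expr1n subrr.
  by rewrite powR0// subr_eq0 lt_eqF.
have tlt : `|t| < 1 by rewrite lt_neqAle tN ler_norml t1.
have powle (a b : R) : 0 < a -> a <= b -> b `^ (r - 1) <= a `^ (r - 1).
  move=> a0 ab; rewrite -[r - 1]opprB !powRN lef_pV2 ?posrE ?powR_gt0//;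
    last exact: lt_le_trans ab.
  apply: ge0_ler_powR => //; rewrite ?subr_ge0 ?ltW// nnegrE ?ltW//.
  exact: lt_le_trans ab.
apply: (@le_trans _ _ ((1 - `|t|) `^ (r - 1))).
  apply: powle; first by rewrite subr_gt0.
  by apply: one_sub_exprn_ge; rewrite t1.
rewrite /h; have [t0|t0] := leP 0 t.
  by rewrite ger0_norm// lerDl powR_ge0.
by rewrite ltr0_norm// opprK lerDr powR_ge0.
Unshelve. all: by end_near. Qed.

End ArcLength.

(** * The function gint on [-1, 1] *)

Section Gint.
Context {R : realType} (k m : nat).
Hypotheses (hk : (0 < k)%N) (hm : (0 < m)%N).

Local Notation r := ((2 * m)%:R^-1 : R).
Local Notation w := (fun t : R => (1 - t ^+ (2 * k)) `^ (r - 1)).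
Local Notation mu := (@lebesgue_measure R).
Local Notation g := (@gint R k m).
Local Notation tau := (@tau R k m).

(** Integrating from -1 replaces the two cases of the oriented integral by one
    formula, from which continuity and derivative can be read off. *)
Lemma gintE (x : R) : -1 <= x <= 1 ->
  g x = parameterized_integral mu (-1) x w - parameterized_integral mu (-1) 0 w.
Proof.
move=> /andP[x1 x2]; rewrite /gint /parameterized_integral/=.
have iw := weight_integrable (R := R) hk hm.
have [x0|x0] := leP 0 x.
- rewrite Rintegral_itvB ?bnd_simp//.
    rewrite Rintegral_itv_obnd_cbnd//; apply: integrableS iw => //.
    by apply: subset_itv; rewrite bnd_simp//; lra.
  by apply: integrableS iw => //; apply: subset_itv; rewrite bnd_simp//; lra.
- rewrite -[RHS]opprB Rintegral_itvB ?bnd_simp//; last exact: ltW.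
    rewrite Rintegral_itv_obnd_cbnd//; apply: integrableS iw => //.
    by apply: subset_itv; rewrite bnd_simp//; lra.
  by apply: integrableS iw => //; apply: subset_itv; rewrite bnd_simp//; lra.
Qed.

Lemma gint_continuous : {within `[-1, 1], continuous g}.
Proof.
have N11 : (-1 : R) <= 1 by lra.
have cG := parameterized_integral_continuous N11 (weight_integrable (R := R) hk hm).
apply: (@subspace_eq_continuous _ _ _ (fun x : R =>
  parameterized_integral mu (-1) x w - parameterized_integral mu (-1) 0 w)).
  by move=> x /[!inE]/=; rewrite in_itv/= => x1; apply/esym; exact: gintE.
by move=> x; apply: cvgB; [exact: cG|exact: cvg_cst].
Qed.

Lemma gint_derive (x : R) : -1 < x < 1 -> is_derive x (1 : R) g (w x).
Proof.
move=> x1; have /andP[? ?] := x1.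
have [||dG GE] := continuous_FTC1_closed _ (weight_integrable (R := R) hk hm)
  _ (weight_continuous (m := m) hk x1).
- by [].
- by [].
apply: (@near_eq_is_derive R R R (fun x : R =>
  parameterized_integral mu (-1) x w - parameterized_integral mu (-1) 0 w) g x 1).
  near=> s; rewrite gintE//; apply/andP; split; apply: ltW; near: s.
    exact: lt_nbhsr.
  exact: lt_nbhsl.
have H : is_derive x (1 : R)
  (fun x : R => parameterized_integral mu (-1) x w) (w x).
  by split => //; rewrite -derive1E.
by apply: is_derive_eq; rewrite subr0.
Unshelve. all: by end_near. Qed.

Lemma gint0 : g 0 = 0.
Proof. by rewrite gintE ?subrr// lerN10 ler01. Qed.

(** The integrand is even, so x |-> g x + g (- x) has derivative 0. *)
Lemma gintN (x : R) : -1 <= x <= 1 -> g (- x) = - g x.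
Proof.
suff H x' : 0 <= x' <= 1 -> g (- x') = - g x'.
  move=> x1; have [x0|x0] := leP 0 x; first by apply: H; lra.
  by have := H (- x); rewrite opprK => ->; rewrite ?opprK//; lra.
move=> {x} /andP[x0 x1].
pose h x := g x + g (- x).
have cNg : {within `[0, x'], continuous (fun x => g (- x))}.
  apply/subspace_continuousP => z /= /[!in_itv]/= z1 P nP.
  have z1' : `[-1, 1]%classic (- z) by rewrite /= in_itv/=; lra.
  have oz : -%R (t : R) @[t --> z] --> - z by exact: opp_continuous.
  have oH : nbhs z [set t | `[-1, 1]%classic (- t) -> P (g (- t))] :=
    oz _ ((subspace_continuousP _ _).1 gint_continuous (- z) z1' P nP).
  suff : nbhs z [set y | `[0, x']%classic y -> P (g (- y))] by [].
  apply: filterS oH => y /= H /[!in_itv]/= y1.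
  by apply: H; rewrite in_itv/=; lra.
have [||c _] := @MVT_segment _ h (fun=> 0) _ _ x0.
- move=> x /[!in_itv]/= /andP[? ?].
  have d1 : is_derive x (1 : R) g (w x) by apply: gint_derive; lra.
  have d2 : is_derive x (1 : R) (g \o -%R) (w (- x) * -1).
    by apply: is_derive1_comp; apply: gint_derive; lra.
  apply: is_derive_eq; rewrite mulrN1 [(- x) ^+ _]exprM sqrrN -exprM subrr//.
- move=> x; apply: cvgD; last exact: cNg.
  apply: (continuous_subspaceW _ gint_continuous).
  by apply: subset_itv; rewrite bnd_simp; lra.
- by rewrite mul0r /h oppr0 gint0 addr0 subr0 => /eqP;
  rewrite addrC addr_eq0 => /eqP.
Qed.

Lemma tau_gint1 : tau = g 1.
Proof.
have N11 : (-1 : R) < 1 by lra.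
have /(continuous_within_itvP _ N11)[_ _] := gint_continuous.
exact/cvg_lim.
Qed.

Lemma gint_lt : {in `[-1, 1] &, {homo g : x y / x < y}}.
Proof.
apply: gtr0_derive1_lt_cc gint_continuous.
  by move=> x /[!in_itv]/= /gint_derive.
move=> x /[!in_itv]/= x1; have d := gint_derive x1.
by rewrite derive1E derive_val; exact: weight_gt0.
Qed.

End Gint.

Lemma gint_itv (R : realType) (k m : nat) (x : R) : (0 < k)%N -> (0 < m)%N ->
  -1 <= x <= 1 -> - tau R k m <= gint k m x <= tau R k m.
Proof.
move=> hk hm x1.
have le a b : -1 <= a <= 1 -> -1 <= b <= 1 ->
    a <= b -> gint k m a <= gint k m b.
  move=> a1 b1; rewrite le_eqVlt => /predU1P[->//|ab].
  by apply/ltW/(gint_lt hk hm) => //; rewrite in_itv.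
have N11 : -1 <= (1 : R) <= 1 by lra.
have N1N1 : -1 <= (-1 : R) <= 1 by lra.
by rewrite tau_gint1// -gintN// !le//; lra.
Qed.

(** * Antiperiodic extension *)

(** The function with f (s + 2a) = - f s that agrees with the given one on
    [-a, a[; the integer n counts the half periods between s and that
    interval. *)
Definition antiperiodic_ext (R : realType) (a : R) (f : R -> R) (s : R) : R :=
  let n := Num.floor ((s + a) / (2 * a)) in (-1) ^ n * f (s - 2 * a * n%:~R).

Section Antiperiodic.
Context {R : realType} (a : R) (f : R -> R).
Hypotheses (a0 : 0 < a) (fa : f a = - f (- a)).

Lemma antiperiodic_extD (s : R) (j : int) :
  antiperiodic_ext a f (s + 2 * a * j%:~R) = (-1) ^ j * antiperiodic_ext a f s.
Proof.
rewrite /antiperiodic_ext.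
have -> : (s + 2 * a * j%:~R + a) / (2 * a) = (s + a) / (2 * a) + j%:~R.
  by field; rewrite gt_eqF.
rewrite floorDrz ?intr_int// intrKfloor intrD mulrA -expfzDr ?oppr_eq0 ?oner_eq0//.
rewrite [(j + _)%R]addrC; congr (_ * f _); ring.
Qed.

(** At s = a the definition uses f (- a) with the opposite sign, which is where
    the hypothesis [fa] enters. *)
Lemma antiperiodic_extE (s : R) : - a <= s <= a -> antiperiodic_ext a f s = f s.
Proof.
move=> /andP[s1 s2]; rewrite /antiperiodic_ext.
have a2 : 0 < 2 * a by rewrite mulr_gt0.
have [sa|sa] := ltP s a.
  have -> : Num.floor ((s + a) / (2 * a)) = 0.
    apply: floor_def; rewrite add0r mulr0z mulr1z ler_pdivlMr// ltr_pdivrMr//.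
    apply/andP; split; lra.
  by rewrite expr0z mulr0 subr0 mul1r.
have -> : s = a by lra.
have -> : Num.floor ((a + a) / (2 * a)) = 1.
  have -> : (a + a) / (2 * a) = 1%:~R by field; rewrite gt_eqF.
  by rewrite intrKfloor.
rewrite expr1z mulr1 mulN1r fa; congr (- f _); ring.
Qed.

Lemma antiperiodic_reduce (s : R) :
  exists2 s0 : R, - a <= s0 < a & exists j : int, s = s0 + 2 * a * j%:~R.
Proof.
have a2 : 0 < 2 * a by rewrite mulr_gt0.
pose n := Num.floor ((s + a) / (2 * a)).
exists (s - 2 * a * n%:~R); last by exists n; ring.
have := floor_itv ((s + a) / (2 * a)); rewrite -/n.
rewrite intrD ler_pdivlMr// ltr_pdivrMr// => /andP[? ?]; apply/andP; split; lra.
Qed.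

End Antiperiodic.

(** * The inverse function of gint *)

Section GinvFacts.
Context {R : realType} (k m : nat).
Hypotheses (hk : (0 < k)%N) (hm : (0 < m)%N).

Local Notation r := ((2 * m)%:R^-1 : R).
Local Notation g := (@gint R k m).
Local Notation ginv := (@ginv R k m).
Local Notation tau := (@tau R k m).

Lemma tau_gt0 : 0 < tau.
Proof.
rewrite tau_gint1// -(gint0 hk hm); apply: (gint_lt hk hm) => //.
  by rewrite in_itv/= lerN10 ler01.
by rewrite in_itv/= lexx (le_trans (lerN10 _)).
Qed.

Lemma gintK (x : R) : -1 <= x <= 1 -> ginv (g x) = x.
Proof.
move=> x1; apply: pinvKV; last by rewrite inE/= in_itv.
move=> y z /[!inE]/= /[!in_itv]/= y1 z1 gyz.
have lt := @gint_lt R k m hk hm.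
have [yz|yz|//] := ltgtP y z.
  by have := lt y z; rewrite !in_itv/= y1 z1 gyz ltxx => /(_ isT isT yz).
by have := lt z y; rewrite !in_itv/= y1 z1 gyz ltxx => /(_ isT isT yz).
Qed.

Lemma gint_surj (s : R) : - tau <= s <= tau -> exists2 x, -1 <= x <= 1 & g x = s.
Proof.
move=> s1; have N11 : (-1 : R) <= 1 by lra.
have gN : g (-1) = - tau by rewrite gintN// ?tau_gint1//; lra.
have [||c /[!in_itv]/= c1 gc] := @IVT _ g (-1) 1 s N11.
- exact: gint_continuous.
- rewrite gN -tau_gint1// min_l ?max_r//; have := tau_gt0; lra.
by exists c.
Qed.

Lemma ginvK (s : R) : - tau <= s <= tau -> g (ginv s) = s.
Proof. by move=> /gint_surj[x x1 <-]; rewrite gintK. Qed.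

Lemma ginv_itv (s : R) : - tau <= s <= tau -> -1 <= ginv s <= 1.
Proof. by move=> /gint_surj[x x1 <-]; rewrite gintK. Qed.

Lemma ginvN (s : R) : - tau <= s <= tau -> ginv (- s) = - ginv s.
Proof.
move=> /gint_surj[x x1 <-]; rewrite -gintN// !gintK//; lra.
Qed.

Lemma ginv_tau : ginv tau = 1.
Proof. by rewrite tau_gint1// gintK//; lra. Qed.

Lemma ginv_itvoo (s : R) : - tau < s < tau -> -1 < ginv s < 1.
Proof.
move=> /andP[s1 s2].
have sT : - tau <= s <= tau by rewrite !ltW.
have := ginv_itv sT => /andP[u1 u2]; rewrite !lt_neqAle u1 u2 !andbT.
have gE := ginvK sT.
apply/andP; split; apply/negP => /eqP E; move: s1 s2.
  by rewrite -gE -E gintN -?tau_gint1// ?ltxx//; lra.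
by rewrite -gE E -tau_gint1// ltxx.
Qed.

Lemma ginv_continuous : {within `[- tau, tau], continuous ginv}.
Proof.
have N11 : (-1 : R) <= 1 by lra.
have -> : - tau = g (-1) by rewrite gintN -?tau_gint1//; lra.
rewrite {2}tau_gint1//.
apply: segment_can_le_continuous => //; first exact: gint_continuous.
by move=> x /[!in_itv]; exact: gintK.
Qed.

(** The nonnegative v with ginv s ^ (2k) + v ^ (2m) = 1. *)
Definition gcos0 (s : R) : R := (1 - ginv s ^+ (2 * k)) `^ r.

Let r0 : 0 < r. Proof. by rewrite invr_gt0 ltr0n muln_gt0. Qed.

Lemma gcos0_exp (s : R) :
  gcos0 s ^+ (2 * m - 1) = (1 - ginv s ^+ (2 * k)) `^ (1 - r).
Proof.
rewrite /gcos0 -powR_mulrn ?powR_ge0// -powRrM; congr (_ `^ _).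
by rewrite natrB ?muln_gt0// mulrBr mulVf ?mulr1// pnatr_eq0 -lt0n muln_gt0.
Qed.

(** Inverse function theorem: 1 / (1 - u^(2k))^(r - 1) = (1 - u^(2k))^(1 - r),
    and 1 - r = r (2m - 1). *)
Lemma ginv_derive (s : R) : - tau < s < tau ->
  is_derive s (1 : R) ginv (gcos0 s ^+ (2 * m - 1)).
Proof.
move=> s1; have sT : - tau <= s <= tau by move/andP: s1 => [/ltW-> /ltW->].
rewrite gcos0_exp -{1}(ginvK sT) -[1 - r]opprB powRN.
have /andP[u1 u2] := ginv_itvoo s1.
apply: (@is_derive_inverse _ g).
- near=> x; apply: gintK; apply/andP; split; apply: ltW; near: x.
    exact: lt_nbhsr.
  exact: lt_nbhsl.
- near=> x; have x1 : -1 < x < 1.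
    by apply/andP; split; near: x; [exact: lt_nbhsr|exact: lt_nbhsl].
  have d := gint_derive hk hm x1.
  exact/differentiable_continuous/derivable1_diffP.
- by apply: gint_derive => //; rewrite u1.
- by rewrite gt_eqF// weight_gt0// u1.
Unshelve. all: by end_near. Qed.

Lemma gcos0_derive (s : R) : - tau < s < tau ->
  is_derive s (1 : R) gcos0 (- (k%:R / m%:R * ginv s ^+ (2 * k - 1))).
Proof.
move=> s1; have du := ginv_derive s1.
have u1 := one_sub_exprn_gt0 hk (ginv_itvoo s1).
have dX : is_derive s (1 : R) (fun s => 1 - ginv s ^+ (2 * k))
    (- ((2 * k)%:R * ginv s ^+ (2 * k - 1) * gcos0 s ^+ (2 * m - 1))).
  have dE : is_derive s (1 : R) (fun s => ginv s ^+ (2 * k)) _ :=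
    is_derive_exprn_comp (n := (2 * k)%N) ltac:(by rewrite muln_gt0) du.
  by apply: is_derive_eq; rewrite add0r mul1r.
have H := @is_derive_powR_comp R (fun s => 1 - ginv s ^+ (2 * k)) r s _ u1 dX.
rewrite /gcos0.
apply: is_derive_eq.
rewrite gcos0_exp.
have E : (1 - ginv s ^+ (2 * k)) `^ (r - 1) *
    (1 - ginv s ^+ (2 * k)) `^ (1 - r) = 1.
  by rewrite -[1 - r]opprB powRN divff// gt_eqF// powR_gt0.
set A := ginv s ^+ (2 * k - 1); set B := _ `^ _ in E *; set D := _ `^ _ in E *.
have -> : r * B * - ((2 * k)%:R * A * D) = - (r * (2 * k)%:R * A * (B * D)).
  by ring.
rewrite E mulr1; congr (- (_ * _)); rewrite !natrM; field.
by rewrite pnatr_eq0 -lt0n.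
Qed.

End GinvFacts.

(** * The generalized sine and cosine *)

Definition gsin (R : realType) (k m : nat) : R -> R :=
  antiperiodic_ext (tau R k m) (@ginv R k m).
Definition gcos (R : realType) (k m : nat) : R -> R :=
  antiperiodic_ext (tau R k m) (@gcos0 R k m).

Section GSin.
Context {R : realType} (k m : nat).
Hypotheses (hk : (0 < k)%N) (hm : (0 < m)%N).

Local Notation r := ((2 * m)%:R^-1 : R).
Local Notation ginv := (@ginv R k m).
Local Notation gcos0 := (@gcos0 R k m).
Local Notation tau := (@tau R k m).
Local Notation u := (@gsin R k m).
Local Notation v := (@gcos R k m).

Let t0 : 0 < tau. Proof. exact: tau_gt0. Qed.

Let r0 : 0 < r. Proof. by rewrite invr_gt0 ltr0n muln_gt0. Qed.

Lemma ginvNtau : ginv tau = - ginv (- tau).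
Proof. by rewrite ginvN ?opprK//; have := t0; lra. Qed.

Lemma gcos0N (s : R) : - tau <= s <= tau -> gcos0 (- s) = gcos0 s.
Proof. by move=> s1; rewrite /gcos0 ginvN// [(- _) ^+ _]exprM sqrrN -exprM. Qed.

Lemma gcos0_tau : gcos0 tau = 0.
Proof. by rewrite /gcos0 ginv_tau// expr1n subrr powR0// gt_eqF. Qed.

Lemma gcos0Ntau : gcos0 tau = - gcos0 (- tau).
Proof. by rewrite gcos0N ?gcos0_tau ?oppr0//; have := t0; lra. Qed.

Lemma gsinD (s : R) (j : int) : u (s + 2 * tau * j%:~R) = (-1) ^ j * u s.
Proof. exact: antiperiodic_extD. Qed.

Lemma gcosD (s : R) (j : int) : v (s + 2 * tau * j%:~R) = (-1) ^ j * v s.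
Proof. exact: antiperiodic_extD. Qed.

Lemma gsinE (s : R) : - tau <= s <= tau -> u s = ginv s.
Proof. by apply: antiperiodic_extE => //; exact: ginvNtau. Qed.

Lemma gcosE (s : R) : - tau <= s <= tau -> v s = gcos0 s.
Proof. by apply: antiperiodic_extE => //; exact: gcos0Ntau. Qed.

Lemma gsin_reflect (s : R) : - tau <= s <= tau -> u (2 * tau - s) = u s.
Proof.
move=> s1; have -> : 2 * tau - s = - s + 2 * tau * 1%:~R by ring.
rewrite gsinD expr1z mulN1r !gsinE ?ginvN ?opprK//; lra.
Qed.

Lemma gcos_reflect (s : R) : - tau <= s <= tau -> v (2 * tau - s) = - v s.
Proof.
move=> s1; have -> : 2 * tau - s = - s + 2 * tau * 1%:~R by ring.
rewrite gcosD expr1z mulN1r !gcosE ?gcos0N//; lra.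
Qed.

Lemma sqr_signz (j : int) : ((-1) ^ j : R) ^+ 2 = 1.
Proof. by rewrite expN1r sqrr_sign. Qed.

(** The sign produced by the extension disappears in the even power, so the
    relation between the two functions holds on the whole line; it carries
    continuity over from [gsin] to [gcos] at the zeros of [gcos]. *)
Lemma norm_gcos (s : R) : `|v s| = `|1 - u s ^+ (2 * k)| `^ r.
Proof.
have [s' s1 [j ->]] := antiperiodic_reduce t0 s.
have s2 : - tau <= s' <= tau by move: s1 => /andP[-> /ltW].
rewrite gsinD gcosD normrM exprMn [((-1) ^ j) ^+ _]exprM sqr_signz expr1n mul1r.
have -> : `|(-1) ^ j : R| = 1.
  by apply/eqP; rewrite -[_ == _](@eqrXn2 _ 2)// -normrX sqr_signz normr1 expr1n.
rewrite mul1r gsinE// gcosE// [`|gcos0 _|]ger0_norm ?powR_ge0// ger0_norm//.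
rewrite subr_ge0 -[_ ^+ _]ger0_norm ?exprn_even_ge0 ?oddM// normrX.
by apply: exprn_ile1 => //; rewrite ler_norml ginv_itv.
Qed.

(** The graph is symmetric about the vertical line through - tau, hence
    gsin t = ginv (|t + tau| - tau) nearby, and one-sided continuity of [ginv]
    suffices. *)
Lemma gsin_continuousNtau : {for - tau, continuous u}.
Proof.
have t0' := t0.
have nearE : \forall t \near (- tau), ginv (`|t + tau| - tau) = u t.
  near=> t.
  have tt : `|- tau - t| < tau by near: t; exact: cvgr_dist_lt.
  have [tp|tn] := leP 0 (t + tau).
    by rewrite ger0_norm// addrK gsinE//; move: tt; rewrite ltr_norml; lra.
  rewrite ltr0_norm//.
  have t1 : - tau <= t + 2 * tau <= tau by move: tt; rewrite ltr_norml => ?; lra.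
  have tE : t = (t + 2 * tau) + 2 * tau * (-1)%:~R by ring.
  rewrite [in RHS]tE gsinD expN1r expr1 mulN1r gsinE// -ginvN//.
  by congr ginv; ring.
have c1 : ginv (`|t + tau| - tau) @[t --> - tau] --> ginv (- tau).
  move=> P nP.
  have tauI : `[- tau, tau]%classic (- tau) by rewrite /= in_itv/=; lra.
  have H : nbhs (- tau) [set y | `[- tau, tau]%classic y -> P (ginv y)] :=
    (subspace_continuousP _ _).1 (ginv_continuous hk hm) (- tau) tauI P nP.
  have phi : `|t + tau| - tau @[t --> - tau] --> - tau.
    have E : - tau = `|- tau + tau| - tau by rewrite addNr normr0 sub0r.
    rewrite [X in _ --> X]E; apply: cvgB; last exact: cvg_cst.
    by apply: cvg_norm; apply: cvgD; [exact: cvg_id|exact: cvg_cst].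
  have H1 := phi _ H.
  have : \forall t \near (- tau), P (ginv (`|t + tau| - tau)).
    near=> t.
    have tt : `|- tau - t| < tau by near: t; exact: cvgr_dist_lt.
    have : `[- tau, tau]%classic (`|t + tau| - tau).
      move: tt; rewrite -opprD normrN addrC => tt.
      by have := normr_ge0 (t + tau); rewrite /= in_itv/= => ?; lra.
    by near: t.
  by [].
rewrite /prop_for /continuous_at gsinE; last lra.
by apply: cvg_trans c1; exact: near_eq_cvg.
Unshelve. all: by end_near. Qed.

Lemma antiperiodic_derive (s : R) (j : int) (f h : R -> R):
  (forall s, f (s + 2 * tau * j%:~R) = (-1) ^ j * f s) ->
  (forall s, h (s + 2 * tau * j%:~R) = (-1) ^ j * h s) ->
  is_derive s (1 : R) f (h s) ->
  is_derive (s + 2 * tau * j%:~R) (1 : R) f (h (s + 2 * tau * j%:~R)).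
Proof.
move=> fD hD dfs; rewrite hD.
have -> : f = (fun t => (-1) ^ j * f (t - 2 * tau * j%:~R)).
  by apply/funext => t; rewrite -fD subrK.
have d1 : is_derive (s + 2 * tau * j%:~R) (1 : R) (fun t => t - 2 * tau * j%:~R) 1.
  by apply: is_derive_eq; rewrite subr0.
have d2 : is_derive (s + 2 * tau * j%:~R) (1 : R)
    (fun t => f (t - 2 * tau * j%:~R)) (h s * 1).
  apply: (@is_derive1_comp _ f (fun t => t - 2 * tau * j%:~R)).
  by rewrite addrK.
by apply: is_derive_eq; rewrite mulr1.
Qed.

Lemma gcos_continuousNtau : {for - tau, continuous v}.
Proof.
have t0' := t0.
have vN : v (- tau) = 0 by rewrite gcosE ?gcos0N ?gcos0_tau//; lra.
have uN : u (- tau) = -1 by rewrite gsinE ?ginvN ?ginv_tau//; lra.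
have H : {for - tau, continuous (fun t => `|1 - u t ^+ (2 * k)| `^ r)}.
  apply: (@continuous_comp R R R (fun t => 1 - u t ^+ (2 * k))
    (fun x => `|x| `^ r)).
    apply: cvgB; first exact: cvg_cst.
    apply: (@continuous_comp R R R u (fun x => x ^+ (2 * k))).
      exact: gsin_continuousNtau.
    exact: exprn_continuous.
  exact: continuous_normr_powR.
have E0 : `|1 - u (- tau) ^+ (2 * k)| `^ r = 0.
  by rewrite uN exprM sqrrN !expr1n subrr normr0 powR0// gt_eqF.
rewrite /prop_for /continuous_at vN; apply: norm_cvg0.
under eq_fun do rewrite norm_gcos.
by move: H; rewrite /prop_for /continuous_at E0.
Qed.

(** Up to a multiple of 2 tau the point is either interior to [-tau, tau], where
    the explicit formulas are differentiable, or the junction - tau, where the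
    equations on both sides are extended by continuity. *)
Lemma gsin_gcos_derive (s : R) :
  is_derive s (1 : R) u (v s ^+ (2 * m - 1)) /\
  is_derive s (1 : R) v (- (k%:R / m%:R * u s ^+ (2 * k - 1))).
Proof.
have t0' := t0.
pose hu s := v s ^+ (2 * m - 1).
pose hv s := - (k%:R / m%:R * u s ^+ (2 * k - 1)).
(* odd powers keep the sign, so both right-hand sides are antiperiodic too *)
have oddX n (j : int) : (0 < n)%N -> (((-1) ^ j : R) ^+ (2 * n - 1)) = (-1) ^ j.
  move=> n0; have {2}-> : (-1) ^ j = ((-1) ^ j : R) ^+ (2 * n - 1).+1 * (-1) ^ j.
    by rewrite -subSn ?muln_gt0// subn1 exprM sqr_signz expr1n mul1r.
  by rewrite exprSr -mulrA -expr2 sqr_signz mulr1.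
have huD (j : int) s' : hu (s' + 2 * tau * j%:~R) = (-1) ^ j * hu s'.
  by rewrite /hu gcosD exprMn oddX.
have hvD (j : int) s' : hv (s' + 2 * tau * j%:~R) = (-1) ^ j * hv s'.
  by rewrite /hv gsinD exprMn oddX// mulrCA mulrN.
have doo t : - tau < t < tau ->
    is_derive t (1 : R) u (hu t) /\ is_derive t (1 : R) v (hv t).
  move=> t1; have t2 : - tau <= t <= tau by move/andP: t1 => [/ltW-> /ltW->].
  have [tl tr] := andP t1.
  have near_in : \forall t' \near t, - tau <= t' <= tau.
    near=> t'; apply/andP; split; apply: ltW; near: t'.
      exact: lt_nbhsr.
    exact: lt_nbhsl.
  split.
    apply: (@near_eq_is_derive R R R ginv u t 1).
      by apply: filterS near_in => t' /gsinE.
    by rewrite /hu gcosE//; exact: ginv_derive.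
  apply: (@near_eq_is_derive R R R gcos0 v t 1).
    by apply: filterS near_in => t' /gcosE.
  by rewrite /hv gsinE//; exact: gcos0_derive.
have dall t (j : int) :
    is_derive t (1 : R) u (hu t) /\ is_derive t (1 : R) v (hv t) ->
    is_derive (t + 2 * tau * j%:~R) (1 : R) u (hu (t + 2 * tau * j%:~R)) /\
    is_derive (t + 2 * tau * j%:~R) (1 : R) v (hv (t + 2 * tau * j%:~R)).
  move=> [du dv]; split.
    by apply: antiperiodic_derive => // s'; rewrite (gsinD, huD).
  by apply: antiperiodic_derive => // s'; rewrite (gcosD, hvD).
have dpunct t : t != - tau -> `|t - - tau| < 2 * tau ->
    is_derive t (1 : R) u (hu t) /\ is_derive t (1 : R) v (hv t).
  rewrite opprK => tN; rewrite ltr_norml => tt.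
  have [tl|tg|tE] := ltgtP t (- tau); last by rewrite tE eqxx in tN.
    have -> : t = (t + 2 * tau) + 2 * tau * (-1)%:~R by ring.
    by apply/dall/doo; lra.
  by apply: doo; lra.
have [s' s1 [j ->]] := antiperiodic_reduce t0 s.
apply: (dall s' j).
have [->|sN] := eqVneq s' (- tau); last first.
  by apply: doo; move: s1; rewrite le_eqVlt eq_sym (negbTE sN).
have t2 : 0 < 2 * tau by lra.
split; apply: (is_derive_punctured t2).
- exact: gsin_continuousNtau.
- apply: (@continuous_comp R R R v (fun x => x ^+ (2 * m - 1))).
    exact: gcos_continuousNtau.
  exact: exprn_continuous.
- by move=> t tN /(dpunct t tN)[].
- exact: gcos_continuousNtau.
- apply: cvgN; apply: cvgM; first exact: cvg_cst.
  apply: (@continuous_comp R R R u (fun x => x ^+ (2 * k - 1))).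
    exact: gsin_continuousNtau.
  exact: exprn_continuous.
- by move=> t tN /(dpunct t tN)[].
Unshelve. all: by end_near. Qed.

End GSin.

(** * Uniqueness *)

(** D s exp (- L s) is nonincreasing. *)
Lemma gronwall0_ge0 (R : realType) (D d : R -> R) (L t : R) :
  (forall s, is_derive s (1 : R) D (d s)) -> (forall s, d s <= L * D s) ->
  D 0 = 0 -> 0 <= t -> D t <= 0.
Proof.
move=> dD dL D0 t0.
pose h s := D s * expR (- L * s).
have dh s : is_derive s (1 : R) h ((d s - L * D s) * expR (- L * s)).
  have d1 : is_derive s (1 : R) (fun s => expR (- L * s)) (expR (- L * s) * - L).
    apply: (@is_derive1_comp _ expR (fun s => - L * s)).
    by apply: is_derive_eq; rewrite /GRing.scale/= mulr1.
  apply: is_derive_eq; rewrite /GRing.scale/=; ring.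
have [|c _] := @MVT_segment _ h _ _ _ t0 (fun s _ => dh s).
  apply: continuous_subspaceT => s; have := dh s => dhs.
  exact/differentiable_continuous/derivable1_diffP.
rewrite /h D0 mul0r !subr0 => E.
have : D t * expR (- L * t) <= 0.
  rewrite E mulr_le0_ge0// mulr_le0_ge0 ?expR_ge0//.
  by rewrite subr_le0.
by rewrite pmulr_lle0 ?expR_gt0.
Qed.

Lemma gronwall0 (R : realType) (D d : R -> R) (L : R) :
  (forall s, is_derive s (1 : R) D (d s)) -> (forall s, `|d s| <= L * D s) ->
  D 0 = 0 -> forall t, D t <= 0.
Proof.
move=> dD dL D0 t; have [t0|/ltW t0] := leP 0 t.
  apply: (gronwall0_ge0 dD _ D0 t0) => s.
  exact: le_trans (ler_norm _) (dL s).
rewrite -[t]opprK; apply: (@gronwall0_ge0 _ (fun s => D (- s))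
  (fun s => d (- s) * -1) L).
- by move=> s; rewrite mulrN1; apply: le_trans (dL _); rewrite -normrN ler_norm.
- by rewrite oppr0.
- by rewrite oppr_ge0.
Qed.

Lemma exprn_lipschitz (R : realType) (n : nat) (B a b : R) :
  `|a| <= B -> `|b| <= B -> `|a ^+ n - b ^+ n| <= n%:R * B ^+ n.-1 * `|a - b|.
Proof.
move=> aB bB; rewrite subrXX normrM mulrC ler_wpM2r//.
apply: le_trans (ler_norm_sum _ _ _) _.
have -> : n%:R * B ^+ n.-1 = \sum_(i < n) B ^+ n.-1.
  by rewrite sumr_const card_ord mulr_natl.
apply: ler_sum => i _.
have -> : n.-1 = (n.-1 - i + i)%N by rewrite subnK// -ltnS; case: n i => // -[].
rewrite normrM !normrX addnK exprD ler_pM ?exprn_ge0// lerXn2r//;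
  by rewrite nnegrE// (le_trans _ aB).
Qed.

Lemma energy_conserved (R : realType) (k m : nat) (p y eta : R) (x xi : R -> R) :
  (0 < k)%N -> (0 < m)%N -> hamilton_solution k m p y eta x xi ->
  forall t, energy k m (x t) (xi t) = energy k m y eta.
Proof.
move=> hk hm [dx dxi x0 xi0] t; rewrite -x0 -xi0.
apply: (@is_derive_0_is_cst _ (fun t => energy k m (x t) (xi t))) => {}t.
have d1 := is_derive_exprn_comp (n := (2 * k)%N)
  ltac:(by rewrite muln_gt0) (dx t).
have d2 := is_derive_exprn_comp (n := (2 * m)%N)
  ltac:(by rewrite muln_gt0) (dxi t).
rewrite /energy; apply: is_derive_eq; rewrite !natrM; ring.
Qed.

(** Either |z| <= 1 or |z| <= z^(2n), so 1 + energy bounds both coordinates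
    without extracting roots. *)
Lemma energy_bound (R : realType) (k m : nat) (a b : R) :
  (0 < k)%N -> (0 < m)%N ->
  `|a| <= 1 + energy k m a b /\ `|b| <= 1 + energy k m a b.
Proof.
move=> hk hm.
have H (z w : R) n l : (0 < n)%N -> `|z| <= 1 + (z ^+ (2 * n) + w ^+ (2 * l)).
  move=> n0; have w0 : 0 <= w ^+ (2 * l) by rewrite exprn_even_ge0 ?oddM.
  have z0 : 0 <= z ^+ (2 * n) by rewrite exprn_even_ge0 ?oddM.
  have [z1|z1] := leP `|z| 1; first by lra.
  suff : `|z| <= z ^+ (2 * n) by lra.
  by rewrite -[leRHS]ger0_norm// normrX -[leLHS]expr1 ler_eXn2l// muln_gt0.
split; first exact: H.
by rewrite /energy [_ ^+ _ + _]addrC; apply: H.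
Qed.

Lemma hamilton_unique (R : realType) (k m : nat) (p y eta : R)
    (x xi x' xi' : R -> R) : (0 < k)%N -> (0 < m)%N ->
  hamilton_solution k m p y eta x xi -> hamilton_solution k m p y eta x' xi' ->
  x' = x /\ xi' = xi.
Proof.
move=> hk hm H H'.
have [eH eH'] := (energy_conserved hk hm H, energy_conserved hk hm H').
case: H => dx dxi x0 xi0; case: H' => dx' dxi' x0' xi0'.
set c := energy k m y eta in dx dxi dx' dxi' eH eH'.
pose B := 1 + c.
have bx t : `|x t| <= B.
  by have [] := energy_bound (x t) (xi t) hk hm; rewrite eH.
have bxi t : `|xi t| <= B.
  by have [] := energy_bound (x t) (xi t) hk hm; rewrite eH.
have bx' t : `|x' t| <= B.
  by have [] := energy_bound (x' t) (xi' t) hk hm; rewrite eH'.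
have bxi' t : `|xi' t| <= B.
  by have [] := energy_bound (x' t) (xi' t) hk hm; rewrite eH'.
set A := 2 * m%:R * p * c `^ (p - 1) in dx dx'.
set C := 2 * k%:R * p * c `^ (p - 1) in dxi dxi'.
pose i := (2 * m - 1)%N; pose j := (2 * k - 1)%N.
pose D t := (x t - x' t) ^+ 2 + (xi t - xi' t) ^+ 2.
pose d t := 2%:R * (x t - x' t) * (A * (xi t ^+ i - xi' t ^+ i)) -
            2%:R * (xi t - xi' t) * (C * (x t ^+ j - x' t ^+ j)).
pose L1 := `|A| * (i%:R * B ^+ i.-1); pose L2 := `|C| * (j%:R * B ^+ j.-1).
have dD t : is_derive t (1 : R) D (d t).
  have := dx t; have := dxi t; have := dx' t; have := dxi' t => h1 h2 h3 h4.
  have e1 : is_derive t (1 : R) (fun t => x t - x' t)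
      (A * (xi t ^+ i - xi' t ^+ i)).
    by apply: is_derive_eq; rewrite mulrBr.
  have e2 : is_derive t (1 : R) (fun t => xi t - xi' t)
      (- (C * (x t ^+ j - x' t ^+ j))).
    by apply: is_derive_eq; rewrite mulrBr opprB addrC opprK.
  have f1 := is_derive_exprn_comp (n := 2) isT e1.
  have f2 := is_derive_exprn_comp (n := 2) isT e2.
  by apply: is_derive_eq; rewrite /d mulrN.
have dL t : `|d t| <= (L1 + L2) * D t.
  pose P := A * (xi t ^+ i - xi' t ^+ i); pose Q := C * (x t ^+ j - x' t ^+ j).
  pose a := `|x t - x' t|; pose b := `|xi t - xi' t|.
  have l1 : `|P| <= L1 * b.
    by rewrite normrM /L1 -mulrA ler_wpM2l// exprn_lipschitz.
  have l2 : `|Q| <= L2 * a.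
    by rewrite normrM /L2 -mulrA ler_wpM2l// exprn_lipschitz.
  have L10 : 0 <= L1.
    by rewrite mulr_ge0// mulr_ge0// exprn_ge0// (le_trans _ (bx t)).
  have L20 : 0 <= L2.
    by rewrite mulr_ge0// mulr_ge0// exprn_ge0// (le_trans _ (bx t)).
  have a0 : 0 <= a by exact: normr_ge0.
  have b0 : 0 <= b by exact: normr_ge0.
  rewrite /d -/P -/Q (_ : D t = a ^+ 2 + b ^+ 2);
    last by rewrite !real_normK ?num_real.
  apply: le_trans (ler_normB _ _) _.
  rewrite [`|_ * P|]normrM [`|_ * Q|]normrM !(normrM 2) normr_nat -/a -/b.
  have ab : 2 * (a * b) <= a ^+ 2 + b ^+ 2.
    by rewrite -subr_ge0; have := sqr_ge0 (a - b); congr (0 <= _); ring.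
  apply: (@le_trans _ _ ((L1 + L2) * (2 * (a * b))));
    last by rewrite ler_wpM2l// addr_ge0.
  have h1 : a * `|P| <= a * (L1 * b) := ler_wpM2l a0 l1.
  have h2 : b * `|Q| <= b * (L2 * a) := ler_wpM2l b0 l2.
  have -> : (L1 + L2) * (2 * (a * b)) =
      2 * (a * (L1 * b)) + 2 * (b * (L2 * a)) by ring.
  lra.
have D0 : D 0 = 0 by rewrite /D x0 x0' xi0 xi0' !subrr expr0n addr0.
have DE t : x t - x' t = 0 /\ xi t - xi' t = 0.
  have := gronwall0 dD dL D0 t; rewrite /D => Dt.
  have := sqr_ge0 (x t - x' t); have := sqr_ge0 (xi t - xi' t) => h1 h2.
  by split; apply/eqP; rewrite -sqrf_eq0; apply/eqP; lra.
split; apply/funext => t; apply/eqP; rewrite eq_sym -subr_eq0; apply/eqP;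
  by have [] := DE t.
Qed.

(** * Smoothness *)

(** Polynomial expressions in the two functions [x] and [xi]; an inductive
    predicate suffices since only stability under differentiation is used. *)
Inductive polynomial_in (R : realType) (x xi : R -> R) : (R -> R) -> Prop :=
| PolyCst a : polynomial_in x xi (fun=> a)
| PolyX : polynomial_in x xi x
| PolyXi : polynomial_in x xi xi
| PolyAdd f g : polynomial_in x xi f -> polynomial_in x xi g ->
    polynomial_in x xi (fun t => f t + g t)
| PolyMul f g : polynomial_in x xi f -> polynomial_in x xi g ->
    polynomial_in x xi (fun t => f t * g t).

Lemma polynomial_in_exprn (R : realType) (x xi f : R -> R) (n : nat) :
  polynomial_in x xi f -> polynomial_in x xi (fun t => f t ^+ n).
Proof.
move=> Pf; elim: n => [|n IH]; first exact: PolyCst.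
have -> : (fun t => f t ^+ n.+1) = (fun t => f t * f t ^+ n).
  by apply/funext => t; rewrite exprS.
exact: PolyMul.
Qed.

Lemma polynomial_in_derive (R : realType) (x xi F G f : R -> R) :
  (forall t, is_derive t (1 : R) x (F t)) ->
  (forall t, is_derive t (1 : R) xi (G t)) ->
  polynomial_in x xi F -> polynomial_in x xi G -> polynomial_in x xi f ->
  exists2 df, polynomial_in x xi df & forall t, is_derive t (1 : R) f (df t).
Proof.
move=> dx dxi PF PG; elim.
- move=> a; exists (fun=> 0); first exact: PolyCst.
  by move=> t; exact: is_derive_cst.
- by exists F.
- by exists G.
- move=> g h Pg [dg Pdg dgE] Ph [dh Pdh dhE].
  exists (fun t => dg t + dh t); first exact: PolyAdd.
  by move=> t; have := dgE t; have := dhE t => ? ?; apply: is_derive_eq.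
- move=> g h Pg [dg Pdg dgE] Ph [dh Pdh dhE].
  exists (fun t => g t * dh t + h t * dg t).
    by apply: PolyAdd; apply: PolyMul.
  by move=> t; have := dgE t; have := dhE t => ? ?; apply: is_derive_eq.
Qed.

Lemma polynomial_in_smooth (R : realType) (x xi F G f : R -> R) :
  (forall t, is_derive t (1 : R) x (F t)) ->
  (forall t, is_derive t (1 : R) xi (G t)) ->
  polynomial_in x xi F -> polynomial_in x xi G -> polynomial_in x xi f ->
  smooth f.
Proof.
move=> dx dxi PF PG Pf.
have step h := @polynomial_in_derive _ _ _ _ _ h dx dxi PF PG.
have Pn n : polynomial_in x xi (derive1n n f).
  elim: n => [//|n IH]; rewrite derive1nS.
  have [dh Pdh dhE] := step _ IH.
  have -> // : derive1 (derive1n n f) = dh.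
  by apply/funext => t; have := dhE t => ?; rewrite derive1E derive_val.
by move=> n t; have [dh _ /(_ t)] := step _ (Pn n).
Qed.

Lemma hamilton_smooth (R : realType) (k m : nat) (p y eta : R) (x xi : R -> R) :
  hamilton_solution k m p y eta x xi -> smooth x /\ smooth xi.
Proof.
move=> [dx dxi _ _].
have PF : polynomial_in x xi (fun t =>
    2 * m%:R * p * energy k m y eta `^ (p - 1) * xi t ^+ (2 * m - 1)).
  by apply: PolyMul; [exact: PolyCst|exact/polynomial_in_exprn/PolyXi].
have PG : polynomial_in x xi (fun t =>
    - (2 * k%:R * p * energy k m y eta `^ (p - 1) * x t ^+ (2 * k - 1))).
  under eq_fun do rewrite -mulNr.
  by apply: PolyMul; [exact: PolyCst|exact/polynomial_in_exprn/PolyX].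
by split; apply: (polynomial_in_smooth dx dxi PF PG); constructor.
Qed.

(** * The symmetry exchanging the two variables *)

Lemma energy_rotate (R : realType) (k m : nat) (y eta : R) :
  energy m k (- eta) y = energy k m y eta.
Proof. by rewrite /energy [(- eta) ^+ _]exprM sqrrN -exprM addrC. Qed.

(** The two equations are exchanged; the signs match because 2m - 1 is odd. *)
Lemma hamilton_rotate (R : realType) (k m : nat) (p y eta : R) (x xi : R -> R) :
  (0 < m)%N ->
  hamilton_solution k m p y eta x xi ->
  hamilton_solution m k p (- eta) y (fun t => - xi t) x.
Proof.
move=> hm [dx dxi x0 xi0]; rewrite /hamilton_solution.
rewrite energy_rotate.
split => [t|t||//]; last by rewrite xi0.
  by have := dxi t => dxit; apply: is_derive_eq; rewrite opprK.
have := dx t => dxt; apply: is_derive_eq.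
rewrite exprNn -signr_odd oddB ?muln_gt0// oddM/= expr1 mulN1r mulrN opprK//.
Qed.

(** * The solution in terms of the generalized sine and cosine *)

(** [speed] is the factor between t and the parameter of the normalized pair,
    [gamma] the parameter of the initial point. *)
Section Param.
Context {R : realType} (k m : nat) (p y eta : R).
Hypotheses (hk : (0 < k)%N) (hm : (0 < m)%N) (c0 : 0 < energy k m y eta).
Hypothesis eta0 : eta != 0.

Local Notation c := (energy k m y eta).
Local Notation tau := (tau R k m).
Local Notation gamma := (gamma0 k m y eta).
Local Notation speed := (2 * m%:R * p * c `^ omega k m p).

Definition hamilton_x (t : R) : R :=
  Num.sg eta * c `^ ((2 * k)%:R^-1) * gsin k m (speed * t + gamma).
Definition hamilton_xi (t : R) : R :=
  Num.sg eta * c `^ ((2 * m)%:R^-1) * gcos k m (speed * t + gamma).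

Let n2k0 : (2 * k)%:R != 0 :> R.
Proof. by rewrite pnatr_eq0 -lt0n muln_gt0. Qed.
Let n2m0 : (2 * m)%:R != 0 :> R.
Proof. by rewrite pnatr_eq0 -lt0n muln_gt0. Qed.
Let cn0 : c != 0. Proof. by rewrite gt_eqF. Qed.

Lemma powR_rootK (n : nat) : (0 < n)%N -> (c `^ n%:R^-1) ^+ n = c.
Proof.
move=> n0; rewrite -powR_mulrn ?powR_ge0// -powRrM mulVf ?powRr1 ?ltW//.
by rewrite pnatr_eq0 -lt0n.
Qed.

Lemma initial_exprn :
  (Num.sg eta * y * c `^ (- (2 * k)%:R^-1)) ^+ (2 * k) = y ^+ (2 * k) / c.
Proof.
rewrite powRN !exprMn exprVn powR_rootK ?muln_gt0// [Num.sg eta ^+ _]exprM.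
by rewrite sqr_sg eta0 expr1n mul1r.
Qed.

(** The normalized initial abscissa z satisfies z^(2k) = y^(2k) / c <= 1. *)
Lemma initial_itv : -1 <= Num.sg eta * y * c `^ (- (2 * k)%:R^-1) <= 1.
Proof.
rewrite -ler_norml -(@ler_pXn2r _ (2 * k)) ?nnegrE ?muln_gt0// expr1n -normrX.
rewrite initial_exprn ger0_norm; last first.
  by rewrite divr_ge0 ?exprn_even_ge0 ?oddM// ltW.
by rewrite ler_pdivrMr// mul1r lerDl exprn_even_ge0 ?oddM.
Qed.

Lemma gamma_itv : - tau <= gamma <= tau.
Proof. by apply: gint_itv => //; exact: initial_itv. Qed.

Lemma hamilton_x0 : hamilton_x 0 = y.
Proof.
rewrite /hamilton_x mulr0 add0r gsinE//; last exact: gamma_itv.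
rewrite gintK//; last exact: initial_itv.
rewrite powRN; have cn : c `^ (2 * k)%:R^-1 != 0 by rewrite gt_eqF ?powR_gt0.
transitivity (Num.sg eta ^+ 2 * y); last by rewrite sqr_sg eta0 mul1r.
by field.
Qed.

Lemma hamilton_xi0 : hamilton_xi 0 = eta.
Proof.
rewrite /hamilton_xi mulr0 add0r gcosE//; last exact: gamma_itv.
rewrite /gcos0 gintK//; last exact: initial_itv.
rewrite initial_exprn -mulrA -powRM; [|exact: ltW|]; last first.
  by rewrite subr_ge0 ler_pdivrMr// mul1r lerDl exprn_even_ge0 ?oddM.
have -> : c * (1 - y ^+ (2 * k) / c) = c - y ^+ (2 * k) by field.
rewrite /energy [y ^+ _ + _]addrC addrK.
rewrite -[eta ^+ _]ger0_norm ?exprn_even_ge0 ?oddM// normrX -powR_mulrn//.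
by rewrite -powRrM mulfV// powRr1// -numEsg.
Qed.

Lemma sg_expr_odd n : (0 < n)%N -> Num.sg eta ^+ (2 * n - 1) = Num.sg eta.
Proof.
by move=> n0; rewrite sgr_odd// oddB ?muln_gt0// oddM expr1.
Qed.

(** This and the next identity are what the exponent omega is chosen for: the
    rescaling turns the normalized equations into the given ones. *)
Lemma speed_x :
  c `^ (2 * k)%:R^-1 * c `^ omega k m p =
  c `^ (p - 1) * (c `^ (2 * m)%:R^-1) ^+ (2 * m - 1).
Proof.
rewrite -powR_mulrn ?powR_ge0// -powRrM -!powRD ?cn0 ?implybT//; congr (_ `^ _).
by rewrite /omega natrB ?muln_gt0// mulrBr mulVf//; ring.
Qed.

Lemma speed_xi :
  c `^ (2 * m)%:R^-1 * c `^ omega k m p =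
  c `^ (p - 1) * (c `^ (2 * k)%:R^-1) ^+ (2 * k - 1).
Proof.
rewrite -powR_mulrn ?powR_ge0// -powRrM -!powRD ?cn0 ?implybT//; congr (_ `^ _).
by rewrite /omega natrB ?muln_gt0// mulrBr mulVf//; ring.
Qed.

Lemma hamilton_param : hamilton_solution k m p y eta hamilton_x hamilton_xi.
Proof.
split; [move=> t|move=> t|exact: hamilton_x0|exact: hamilton_xi0].
- have [du dv] := gsin_gcos_derive hk hm (speed * t + gamma).
  have dl : is_derive t (1 : R) (fun t => speed * t + gamma) speed.
    by apply: is_derive_eq; rewrite addr0 /GRing.scale/= mulr1.
  have dul := @is_derive1_comp _ _ (fun t => speed * t + gamma) t _ _ du dl.
  rewrite /hamilton_x; apply: is_derive_eq.
  rewrite /hamilton_xi [(_ * gcos _ _ _) ^+ _]exprMn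
    [(Num.sg _ * _) ^+ _]exprMn sg_expr_odd// /GRing.scale/=.
  have := speed_x; set A := c `^ _; set B := c `^ _;
  set C := (c `^ _) ^+ (2 * m - 1).
  set V := gcos _ _ _ ^+ _ => E.
  transitivity (2 * m%:R * p * Num.sg eta * V * (A * B)); first by ring.
  by rewrite E; ring.
- have [du dv] := gsin_gcos_derive hk hm (speed * t + gamma).
  have dl : is_derive t (1 : R) (fun t => speed * t + gamma) speed.
    by apply: is_derive_eq; rewrite addr0 /GRing.scale/= mulr1.
  have dvl := @is_derive1_comp _ _ (fun t => speed * t + gamma) t _ _ dv dl.
  rewrite /hamilton_xi; apply: is_derive_eq.
  rewrite /hamilton_x [(_ * gsin _ _ _) ^+ _]exprMn
    [(Num.sg _ * _) ^+ _]exprMn sg_expr_odd// /GRing.scale/=.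
  have := speed_xi; set A := c `^ _; set B := c `^ _;
  set C := (c `^ _) ^+ (2 * k - 1).
  set U := gsin _ _ _ ^+ _ => E.
  have m0 : m%:R != 0 :> R by rewrite pnatr_eq0 -lt0n.
  transitivity (- (2 * k%:R * p * Num.sg eta * U * (A * B))); first by field.
  by rewrite E; ring.
Qed.

End Param.

(** The sign of [S] decides the order of [a] and [b], which [between] leaves
    open; so p > 0 and p < 0 are treated together. *)
Lemma between_affine (R : realType) (S g a b t : R) :
  S != 0 -> S * a + g <= S * b + g -> between a b t ->
  S * a + g <= S * t + g <= S * b + g.
Proof.
move=> S0; rewrite !lerD2r /between.
have [Sgt|Slt] : 0 < S \/ S < 0 by move: S0; rewrite neq_lt => /orP[]; [right|left].
  by rewrite !ler_pM2l// => ab; rewrite min_l// max_r.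
by rewrite !ler_nM2l// => ab; rewrite min_r// max_l// andbC.
Qed.

Section EtaForm.
Context {R : realType} (k m : nat) (p y eta : R) (x xi : R -> R).
Hypotheses (hk : (0 < k)%N) (hm : (0 < m)%N) (hp : p != 0).
Hypothesis c0 : 0 < energy k m y eta.
Hypothesis eta0 : eta != 0.
Hypothesis sol : hamilton_solution k m p y eta x xi.

Local Notation c := (energy k m y eta).
Local Notation tau := (tau R k m).
Local Notation gamma := (gamma0 k m y eta).
Local Notation speed := (2 * m%:R * p * c `^ omega k m p).
Local Notation t1 := (T1 k m p y eta).
Local Notation t2 := (T2 k m p y eta).

Let xE t : x t = hamilton_x k m p y eta t.
Proof.
by have [-> _] := hamilton_unique hk hm (hamilton_param p hk hm c0 eta0) sol.
Qed.

Let xiE t : xi t = hamilton_xi k m p y eta t.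
Proof.
by have [_ ->] := hamilton_unique hk hm (hamilton_param p hk hm c0 eta0) sol.
Qed.

Lemma speed_neq0 : speed != 0.
Proof.
by rewrite !mulf_neq0 ?pnatr_eq0 -?lt0n// gt_eqF// powR_gt0.
Qed.

Lemma speed_scale (w : R) :
  speed * ((2 * m%:R * p)^-1 * c `^ (- omega k m p) * w) = w.
Proof.
have cw : c `^ omega k m p != 0 by rewrite gt_eqF ?powR_gt0.
have m0 : m%:R != 0 :> R by rewrite pnatr_eq0 -lt0n.
by rewrite powRN; field; rewrite hp m0 cw.
Qed.

Lemma speed_T1 : speed * t1 + gamma = - tau.
Proof. by rewrite speed_scale subrK. Qed.

Lemma speed_T2 : speed * t2 + gamma = tau.
Proof. by rewrite speed_scale subrK. Qed.

(** The time span T is two half periods 2 tau of the normalized pair, hence the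
    factor 2 on the integer and the disappearance of the sign. *)
Lemma speed_period (n : int) (t : R) :
  speed * (t - n%:~R * (2 * (t2 - t1))) + gamma =
  (speed * t + gamma) + 2 * tau * (- n * 2)%:~R.
Proof.
have E : speed * (t2 - t1) = 2 * tau.
  have := speed_T1; have := speed_T2; rewrite mulrBr => h1 h2; lra.
transitivity (speed * t + gamma - n%:~R * 2 * (speed * (t2 - t1))); first by ring.
rewrite E intrM intrN; ring.
Qed.

Lemma hamilton_period (n : int) (t : R) :
  x (t - n%:~R * (2 * (t2 - t1))) = x t /\
  xi (t - n%:~R * (2 * (t2 - t1))) = xi t.
Proof.
rewrite !xE !xiE /hamilton_x /hamilton_xi speed_period gsinD// gcosD//.
by rewrite -exprz_exp -exprnP sqr_signz !mul1r.
Qed.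

Lemma hamilton_eta_form :
  let T := 2 * (t2 - t1) in
  [/\ forall t : R, between t1 t2 t ->
        x t = f1 k m p y eta t /\ xi t = f2 k m p y eta t,
      forall t : R, between t2 (2 * t2 - t1) t ->
        x t = f1 k m p y eta (2 * t2 - t) /\
        xi t = - f2 k m p y eta (2 * t2 - t)
    & forall (n : int) (t : R),
        between (t1 + n%:~R * T) (t1 + (n + 1)%:~R * T) t ->
        x t = x (t - n%:~R * T) /\ xi t = xi (t - n%:~R * T)].
Proof.
have tau0 := tau_gt0 hk hm (R := R).
have tau_le : - tau <= tau by lra.
split.
- move=> t /(between_affine (g := gamma) speed_neq0);
  rewrite speed_T1 speed_T2 => /(_ tau_le) st.
  by rewrite xE xiE /hamilton_x /hamilton_xi gsinE// gcosE.
- move=> t bt.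
  (* in normalized time the reflection at t2 is the one at tau *)
  have st : - tau <= speed * (2 * t2 - t) + gamma <= tau.
    have E2 : speed * (2 * t2 - t1) + gamma = 3 * tau.
      transitivity (2 * (speed * t2 + gamma) - (speed * t1 + gamma)); first by ring.
      by rewrite speed_T1 speed_T2; ring.
    have := between_affine (g := gamma) speed_neq0 _ bt; rewrite speed_T2 E2 => h.
    have {}h : tau <= speed * t + gamma <= 3 * tau by apply: h; lra.
    have -> : speed * (2 * t2 - t) + gamma = 2 * tau - (speed * t + gamma).
      by rewrite -[in RHS]speed_T2; ring.
    lra.
  rewrite xE xiE /hamilton_x /hamilton_xi.
  have -> : speed * t + gamma = 2 * tau - (speed * (2 * t2 - t) + gamma).
    by rewrite -[tau in RHS]speed_T2; ring.
  by rewrite gsin_reflect// gcos_reflect// gsinE// gcosE// mulrN.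
- by move=> n t _; have [-> ->] := hamilton_period n t.
Qed.

Lemma hamilton_periodic : exists P : R, [/\ 0 < P, periodic x P & periodic xi P].
Proof.
have tau0 := tau_gt0 hk hm (R := R).
have T0 : t2 - t1 != 0.
  apply/eqP => T0; have := speed_T1; have := speed_T2.
  move/subr0_eq : T0 => ->; lra.
have P1 s : x (s + 2 * (t2 - t1)) = x s /\ xi (s + 2 * (t2 - t1)) = xi s.
  by have := hamilton_period (-1) s; rewrite intrN mulN1r opprK.
have P2 s : x (s - 2 * (t2 - t1)) = x s /\ xi (s - 2 * (t2 - t1)) = xi s.
  by have := hamilton_period 1 s; rewrite mul1r.
exists `|2 * (t2 - t1)|; split; first by rewrite normr_gt0 mulf_neq0.
- by move=> s; have [h|h] := leP 0 (2 * (t2 - t1));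
    rewrite ?(ger0_norm h) ?(ltr0_norm h); [have [] := P1 s|have [] := P2 s].
- by move=> s; have [h|h] := leP 0 (2 * (t2 - t1));
    rewrite ?(ger0_norm h) ?(ltr0_norm h); [have [] := P1 s|have [] := P2 s].
Qed.

End EtaForm.

Section YForm.
Context {R : realType} (k m : nat) (p y eta : R) (x xi : R -> R).
Hypotheses (hk : (0 < k)%N) (hm : (0 < m)%N) (hp : p != 0).
Hypothesis c0 : 0 < energy k m y eta.
Hypothesis y0 : y != 0.

(** Each quantity of the case y != 0 is the corresponding one of the case
    eta != 0 after the rotation; kappa changes sign as [gint] is odd. *)
Let energyE := energy_rotate k m y eta.

Let omegaE : omega m k p = omega k m p.
Proof. by rewrite /omega addrAC. Qed.

Let c0' : 0 < energy m k (- eta) y. Proof. by rewrite energyE. Qed.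

Let gammaE : gamma0 m k (- eta) y = - kappa0 k m y eta.
Proof.
have := initial_itv hm c0' y0.
rewrite /gamma0 /kappa0 energyE mulrN mulNr => H; apply: gintN => //; lra.
Qed.

Let T1E : T1 m k p (- eta) y = T3 k m p y eta.
Proof. by rewrite /T1 /T3 energyE omegaE gammaE opprK. Qed.

Let T2E : T2 m k p (- eta) y = T4 k m p y eta.
Proof. by rewrite /T2 /T4 energyE omegaE gammaE opprK. Qed.

Let f1E t : f1 m k p (- eta) y t = f4 k m p y eta t.
Proof. by rewrite /f1 /f4 energyE omegaE gammaE. Qed.

Let f2E t : f2 m k p (- eta) y t = f3 k m p y eta t.
Proof. by rewrite /f2 /f3 energyE omegaE gammaE. Qed.

Lemma hamilton_y_form : hamilton_solution k m p y eta x xi ->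
  let t3 := T3 k m p y eta in
  let t4 := T4 k m p y eta in
  let T := 2 * (t4 - t3) in
  [/\ forall t : R, between t3 t4 t ->
        x t = f3 k m p y eta t /\ xi t = - f4 k m p y eta t,
      forall t : R, between t4 (2 * t4 - t3) t ->
        x t = - f3 k m p y eta (2 * t4 - t) /\
        xi t = - f4 k m p y eta (2 * t4 - t)
    & forall (n : int) (t : R),
        between (t3 + n%:~R * T) (t3 + (n + 1)%:~R * T) t ->
        x t = x (t - n%:~R * T) /\ xi t = xi (t - n%:~R * T)].
Proof.
move=> /(hamilton_rotate hm) sol.
have [] := hamilton_eta_form hm hk hp c0' y0 sol.
rewrite T1E T2E => F1 F2 F3; split.
- by move=> t /F1[]; rewrite f1E f2E => <- ->; rewrite opprK.
- by move=> t /F2[]; rewrite f1E f2E => <- ->; rewrite opprK.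
- by move=> n t /F3[/oppr_inj ? ?].
Qed.

(** The rotation has order 4, so its inverse is its third power. *)
Lemma hamilton_exists_y : exists x xi, hamilton_solution k m p y eta x xi.
Proof.
have := hamilton_rotate hk (hamilton_rotate hm (hamilton_rotate hk
  (hamilton_param p hm hk c0' y0))).
by rewrite !opprK => H; eexists; eexists; exact: H.
Qed.

End YForm.

Theorem theorem4p7 (R : realType) (k m : nat) (p : R)
    (hk : (0 < k)%N) (hm : (0 < m)%N) (hp : p != 0)
    (y eta : R) (hc : 0 < energy k m y eta) :
  exists x xi : R -> R,
    [/\ hamilton_solution k m p y eta x xi,
        forall x' xi' : R -> R, hamilton_solution k m p y eta x' xi' ->
          x' = x /\ xi' = xi,
        smooth x /\ smooth xi,
        exists P : R, [/\ 0 < P, periodic x P & periodic xi P]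
      & (eta != 0 ->
           let t1 := T1 k m p y eta in
           let t2 := T2 k m p y eta in
           let T := 2 * (t2 - t1) in
           [/\ forall t : R, between t1 t2 t ->
                 x t = f1 k m p y eta t /\ xi t = f2 k m p y eta t,
               forall t : R, between t2 (2 * t2 - t1) t ->
                 x t = f1 k m p y eta (2 * t2 - t) /\
                 xi t = - f2 k m p y eta (2 * t2 - t)
             & forall (n : int) (t : R),
                 between (t1 + n%:~R * T) (t1 + (n + 1)%:~R * T) t ->
                 x t = x (t - n%:~R * T) /\ xi t = xi (t - n%:~R * T)]) /\
        (y != 0 ->
           let t3 := T3 k m p y eta in
           let t4 := T4 k m p y eta in
           let T := 2 * (t4 - t3) in
           [/\ forall t : R, between t3 t4 t ->
                 x t = f3 k m p y eta t /\ xi t = - f4 k m p y eta t,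
               forall t : R, between t4 (2 * t4 - t3) t ->
                 x t = - f3 k m p y eta (2 * t4 - t) /\
                 xi t = - f4 k m p y eta (2 * t4 - t)
             & forall (n : int) (t : R),
                 between (t3 + n%:~R * T) (t3 + (n + 1)%:~R * T) t ->
                 x t = x (t - n%:~R * T) /\ xi t = xi (t - n%:~R * T)])].
Proof.
have y_or_eta : eta != 0 \/ y != 0.
  have [eta0|] := eqVneq eta 0; last by left.
  have [y0|] := eqVneq y 0; last by right.
  by move: hc; rewrite /energy y0 eta0 !expr0n !muln_eq0 !gtn_eqF// addr0 ltxx.
have [x [xi sol]] : exists x xi, hamilton_solution k m p y eta x xi.
  have [eta0|y0] := y_or_eta; last exact: hamilton_exists_y.
  by exists (hamilton_x k m p y eta), (hamilton_xi k m p y eta); exact: hamilton_param.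
exists x, xi; split.
- exact: sol.
- by move=> x' xi'; exact: hamilton_unique.
- exact: hamilton_smooth sol.
- have [eta0|y0] := y_or_eta; first exact: hamilton_periodic sol.
  have hc' : 0 < energy m k (- eta) y by rewrite energy_rotate.
  have [P [P0 Pxi Px]] := hamilton_periodic hm hk hp hc' y0 (hamilton_rotate hm sol).
  by exists P; split => // s; apply: oppr_inj; exact: Pxi.
- by split => [eta0|y0]; [exact: hamilton_eta_form|exact: hamilton_y_form].
Qed.
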